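(* Fix an integer $i$ and real numbers $0 < \gamma < \delta \le 1$. The probability that a permutation of $[n]$ chosen uniformly at random has exactly $i$ cycles with length in $[\gamma n, \delta n]$ approaches a limit as $n \to \infty$.
   Context: $[n]=\{1,\dots,n\}$. *)

(* Defs.v *)
From mathcomp Require Import all_boot all_order all_fingroup all_algebra.
From mathcomp Require Import all_classical all_reals all_analysis.
Import Order.TTheory GRing.Theory Num.Theory.
Import numFieldNormedType.Exports.

Set Implicit Arguments.
Unset Strict Implicit.
Unset Printing Implicit Defensive.

Local Open Scope ring_scope.

(* A cycle of s is an element of [porbits s], the set of orbits of s on its
   underlying type: fixed points count as cycles of length 1, and the length
   of a cycle is its cardinality. *)
Definition cycles_between (R : realType) (n : nat) (a b : R) (s : 'S_n) :
  {set {set 'I_n}} :=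
  [set c in porbits s | a <= #|c|%:R <= b]%SET.

Definition uniform_prob (R : realType) (T : finType) (E : {set T}) : R :=
  #|E|%:R / #|T|%:R.

Definition prob_cycles (R : realType) (gamma delta : R) (i : int) (n : nat) : R :=
  uniform_prob R
    [set s : 'S_n |
       #|cycles_between (gamma * n%:R) (delta * n%:R) s|%:Z == i]%SET.

(* Main.v *)
Require Import Defs.
From mathcomp Require Import all_boot all_order all_fingroup all_algebra.
From mathcomp Require Import all_classical all_reals all_analysis.
From mathcomp Require Import lra zify.
Import Order.TTheory GRing.Theory Num.Theory.
Import numFieldNormedType.Exports.

Set Implicit Arguments.
Unset Strict Implicit.
Unset Printing Implicit Defensive.

(** The proof turns the probability into an iterated Riemann sum and shows that
    such sums are Cauchy, without computing the limit.

    Let X be the number of cycles whose length lies in the window P, for a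
    uniform permutation of n points, and write E_n for the expectation. Marking
    a point x and removing the l points of its cycle leaves a uniform
    permutation of n - l points, and the length of the cycle of x is uniform on
    1..n. Summing over the marked points of the counted cycles gives
      E_n(X g(X - 1)) = sum over l <= n with P l of E_(n-l)(g) / l.
    Every function h has the form h(X) = h(0) + X g(X - 1), where
    g(m) = (h(m + 1) - h(0)) / (m + 1); hence [mean_cycles_rec]:
      E_n(h) = h(0) + sum over l <= n with P l of E_(n-l)(g) / l.

    Take for P the lengths between gamma N and delta N, and for h the indicator
    of i. Each use of the recursion removes at least gamma N points, so after
    about 1 / gamma uses no point is left ([mean_cycles_unrolled]): E_N(h) is an
    expression of bounded depth built from constants by the operation
      f |-> (1/N) sum over l <= n of W(l/N) f(N, n - l),
    where W(x) = 1/x on [gamma, delta] and W = 0 elsewhere.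

    This operation is a discretised convolution integral. It preserves
    [grid_regular], the class of bounded, Lipschitz arrays f(N, n) that change by
    O(1/N) when the grid is refined from N to m N
    ([grid_regular_riemann_conv]). The jumps of W are harmless because W is a
    difference of bounded decreasing functions, and the oscillations of a
    decreasing function over successive cells telescope. For a grid regular
    f, the values f(N, N) and f(M, M) are both close to f(N M, N M), so the
    diagonal is a Cauchy sequence ([grid_regular_cvg]). *)

(** * Inserting a point into a permutation *)

Local Open Scope ring_scope.

Definition cycles_of_length (T : finType) (P : pred nat) (s : {perm T}) :
  {set {set T}} := [set c in porbits s | P #|c|]%SET.

Definition cycles_avoiding (T : finType) (P : pred nat) (s : {perm T}) (x : T) :
  {set {set T}} := [set c in cycles_of_length P s | x \notin c]%SET.

Lemma porbit_sub (T : finType) (s : {perm T}) (x : T) (A : {set T}) :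
  x \in A -> (forall y, y \in A -> s y \in A) -> porbit s x \subset A.
Proof.
move=> xA sA; apply/fintype.subsetP => _ /porbitP[i ->].
elim: i => [|i IHi]; first by rewrite expg0 perm1.
by rewrite expgSr permM sA.
Qed.

Lemma porbit_closed (T : finType) (s : {perm T}) (x y : T) :
  (s y \in porbit s x) = (y \in porbit s x).
Proof. by rewrite -!eq_porbit_mem (porbit_perm s 1). Qed.

Lemma mem_porbits (T : finType) (s : {perm T}) (c : {set T}) x :
  c \in porbits s -> (x \in c) = (c == porbit s x).
Proof. by case/imsetP => y _ ->; rewrite eq_sym eq_porbit_mem. Qed.

Section Insertion.
Variables (n : nat) (x : 'I_n.+1).

(** [x] becomes the image of [y] and maps to the former image of [y]; for
    [y = x] the point [x] is fixed. *)
Definition insert_after (y : 'I_n.+1) (s : 'S_n) : 'S_n.+1 :=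
  (tperm x y * lift_perm x x s)%g.

Lemma insert_after_inj : injective (fun p => insert_after p.1 p.2).
Proof.
move=> [y s] [z t] /= E.
have pre u v : insert_after u v u = x.
  by rewrite permM tpermR lift_perm_id.
have yz : y = z.
  by apply: (@perm_inj _ (insert_after y s)); rewrite pre E pre.
subst z; congr (_, _); move/mulgI: E => /permP E.
by apply/permP => k; apply: (@lift_inj _ x); rewrite -!(lift_perm_lift x).
Qed.

(** Each permutation arises once by inserting [x], since it determines the
    preimage of [x] and the permutation obtained by skipping [x]; the case of a
    fixed point is kept apart. *)
Lemma sum_insert (V : nmodType) (F : 'S_n.+1 -> V) :
  \sum_s F s = \sum_(s : 'S_n) F (lift_perm x x s)
             + \sum_(j : 'I_n) \sum_(s : 'S_n) F (insert_after (lift x j) s).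
Proof.
have bij : bijective (fun p => insert_after p.1 p.2).
  apply: inj_card_bij; first exact: insert_after_inj.
  by rewrite card_prod !card_Sn card_ord factS.
rewrite (reindex _ (onW_bij _ bij)) /=.
rewrite -(pair_bigA _ (fun y s => F (insert_after y s))) /=.
rewrite (bigD1_ord x) //=; congr (_ + _); apply: eq_bigr => s _.
by rewrite /insert_after tperm1 mul1g.
Qed.

Section Orbits.
Variables (j : 'I_n) (s : 'S_n).
Let t := insert_after (lift x j) s.

Lemma insert_at : t x = lift x (s j).
Proof. by rewrite permM tpermL lift_perm_lift. Qed.

Lemma insert_pre : t (lift x j) = x.
Proof. by rewrite permM tpermR lift_perm_id. Qed.

Lemma insert_lift k : k != j -> t (lift x k) = lift x (s k).
Proof.
move=> kj; rewrite permM tpermD ?lift_perm_lift ?neq_lift //.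
by rewrite (inj_eq lift_inj) eq_sym.
Qed.

Lemma porbit_insert : porbit t x = x |: lift x @: porbit s j.
Proof.
apply/eqP; rewrite finset.eqEsubset; apply/andP; split.
  apply: porbit_sub; first by rewrite finset.setU11.
  move=> _ /finset.setU1P[->|/imsetP[k kj ->]].
    by rewrite insert_at finset.setU1r // imset_f // porbit_closed porbit_id.
  have [->|nkj] := eqVneq k j; first by rewrite insert_pre finset.setU11.
  by rewrite insert_lift // finset.setU1r // imset_f // porbit_closed.
apply/fintype.subsetP => _ /finset.setU1P[->|/imsetP[k kj ->]]; first exact: porbit_id.
have /fintype.subsetP/(_ k kj) :
    porbit s j \subset [set k | lift x k \in porbit t x]%SET.
  apply: porbit_sub; first by rewrite inE -porbit_closed insert_pre porbit_id.
  move=> l; rewrite !inE => ljx.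
  have [->|nlj] := eqVneq l j; first by rewrite -insert_at porbit_closed porbit_id.
  by rewrite -insert_lift // porbit_closed.
by rewrite inE.
Qed.

Lemma card_porbit_insert : #|porbit t x| = #|porbit s j|.+1.
Proof.
rewrite porbit_insert cardsU1 (card_imset _ lift_inj).
suff -> : x \notin lift x @: porbit s j by [].
by apply/imsetP => -[k _ /eqP]; rewrite (negPf (neq_lift _ _)).
Qed.

Lemma porbit_insert_lift k :
  j \notin porbit s k -> porbit t (lift x k) = lift x @: porbit s k.
Proof.
move=> jk; apply/eqP; rewrite finset.eqEsubset; apply/andP; split.
  apply: porbit_sub; first by rewrite imset_f // porbit_id.
  move=> _ /imsetP[l lk ->]; rewrite insert_lift ?imset_f ?porbit_closed //.
  by apply: contraNneq jk => <-.
apply/fintype.subsetP => _ /imsetP[l lk ->].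
have /fintype.subsetP/(_ l lk) : porbit s k \subset
    [set l in porbit s k | lift x l \in porbit t (lift x k)]%SET.
  apply: porbit_sub; first by rewrite inE !porbit_id.
  move=> m; rewrite !inE => /andP[mk mtk]; rewrite porbit_closed mk /=.
  rewrite -insert_lift ?porbit_closed //.
  by apply: contraNneq jk => <-.
by rewrite inE => /andP[].
Qed.

(** The cycles away from the insertion place are unchanged, up to relabelling
    the points by [lift x]. *)
Lemma card_cycles_avoiding_insert P :
  #|cycles_avoiding P t x| = #|cycles_avoiding P s j|.
Proof.
have injL : injective (fun c : {set 'I_n} => lift x @: c).
  by apply: imset_inj; apply: lift_inj.
rewrite -(card_imset _ injL); congr #|pred_of_set _|; apply/finset.setP => c.
apply/idP/imsetP => [|[d + ->]].
  rewrite !inE => /andP[/andP[/imsetP[y _ ->] Py] xy].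
  case: (unliftP x y) Py xy => [k|] ->; last by rewrite porbit_id.
  move=> Pk xk; have jk : j \notin porbit s k.
    apply: contra xk => kj.
    by rewrite porbit_sym porbit_insert finset.setU1r // imset_f // porbit_sym.
  rewrite porbit_insert_lift // in Pk xk *.
  exists (porbit s k) => //; rewrite !inE jk imset_f //=.
  by rewrite (card_imset _ lift_inj) in Pk; rewrite Pk.
rewrite !inE => /andP[/andP[/imsetP[k _ ->] Pk] jk].
rewrite -porbit_insert_lift // imset_f //= porbit_insert_lift //.
rewrite (card_imset _ lift_inj) Pk /=.
by apply/imsetP => -[l _ /eqP]; rewrite (negPf (neq_lift _ _)).
Qed.

End Orbits.

Section FixedPoint.
Variable (s : 'S_n).
Let t := lift_perm x x s.

Lemma porbit_lift_id : porbit t x = [set x]%SET.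
Proof.
apply/eqP; rewrite finset.eqEsubset finset.sub1set porbit_id andbT; apply: porbit_sub.
  by rewrite finset.set11.
by move=> y /finset.set1P->; rewrite lift_perm_id finset.set11.
Qed.

Lemma porbit_lift k : porbit t (lift x k) = lift x @: porbit s k.
Proof.
apply/eqP; rewrite finset.eqEsubset; apply/andP; split.
  apply: porbit_sub; first by rewrite imset_f // porbit_id.
  by move=> _ /imsetP[l lk ->]; rewrite lift_perm_lift imset_f ?porbit_closed.
apply/fintype.subsetP => _ /imsetP[l lk ->].
have /fintype.subsetP/(_ l lk) : porbit s k \subset
    [set l | lift x l \in porbit t (lift x k)]%SET.
  apply: porbit_sub; first by rewrite inE porbit_id.
  by move=> m; rewrite !inE => mtk; rewrite -(lift_perm_lift x) porbit_closed.
by rewrite inE.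
Qed.

Lemma card_cycles_avoiding_lift P :
  #|cycles_avoiding P t x| = #|cycles_of_length P s|.
Proof.
have injL : injective (fun c : {set 'I_n} => lift x @: c).
  by apply: imset_inj; apply: lift_inj.
rewrite -(card_imset _ injL); congr #|pred_of_set _|; apply/finset.setP => c.
apply/idP/imsetP => [|[d + ->]].
  rewrite !inE => /andP[/andP[/imsetP[y _ ->] Py] xy].
  case: (unliftP x y) Py xy => [k|] ->; last by rewrite porbit_id.
  rewrite porbit_lift (card_imset _ lift_inj) => Pk xk.
  by exists (porbit s k); rewrite // !inE Pk imset_f.
rewrite !inE => /andP[/imsetP[k _ ->] Pk].
rewrite -porbit_lift imset_f //= porbit_lift (card_imset _ lift_inj) Pk /=.
by apply/imsetP => -[l _ /eqP]; rewrite (negPf (neq_lift _ _)).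
Qed.

End FixedPoint.
End Insertion.

(** * Removing a cycle from a random permutation *)

Section Recursion.
Variables (R : numFieldType) (P : pred nat).

Definition mean_cycles (n : nat) (h : nat -> R) : R :=
  (\sum_(s : 'S_n) h #|cycles_of_length P s|) / n`!%:R.

Lemma factR_neq0 n : n`!%:R != 0 :> R.
Proof. by rewrite pnatr_eq0 -lt0n fact_gt0. Qed.

(** The cycle of [x] has each length [l.+1] in [1..n.+1] with the same
    probability, and the points outside it then carry a uniform permutation. By
    induction on the number of points: skipping [x] shortens its cycle by one
    and moves the mark to one of the other points, whence the shift of [u] in the
    induction. *)
Lemma sum_marked_cycle n (x : 'I_n.+1) (u g : nat -> R) :
  \sum_(s : 'S_n.+1) u #|porbit s x| * g #|cycles_avoiding P s x| =
  n`!%:R * \sum_(l < n.+1) u l.+1 * mean_cycles (n - l) g.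
Proof.
have fixed m (y : 'I_m.+1) v : \sum_(s : 'S_m) v #|porbit (lift_perm y y s) y| *
      g #|cycles_avoiding P (lift_perm y y s) y| = m`!%:R * (v 1 * mean_cycles m g).
  rewrite mulrCA [X in _ * X]mulrC divfK ?factR_neq0 // mulr_sumr.
  by apply: eq_bigr => s _; rewrite porbit_lift_id cards1 card_cycles_avoiding_lift.
elim: n => [|n IHn] in x u *; rewrite (sum_insert x) fixed.
  by rewrite [X in _ + X]big_ord0 addr0 big_ord1.
rewrite [in RHS]big_ord_recl mulrDr; congr (_ + _).
under eq_bigr => j _.
  under eq_bigr => s _ do
    rewrite card_porbit_insert card_cycles_avoiding_insert.
  rewrite (IHn j (fun l => u l.+1)).
  over.
by rewrite /= sumr_const card_ord -[LHS]mulr_natl mulrA -natrM -factS.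
Qed.

(** Each cycle of length [l] is counted by its [l] points, each with
    weight [1 / l]. *)
Lemma sum_over_cycles n (s : 'S_n) (g : nat -> R) :
  #|cycles_of_length P s|%:R * g #|cycles_of_length P s|.-1 =
  \sum_(x : 'I_n)
    (P #|porbit s x|)%:R / #|porbit s x|%:R * g #|cycles_avoiding P s x|.
Proof.
rewrite (partition_big (porbit s) (mem (porbits s))) => [|x _] /=; last exact: imset_f.
rewrite -[X in X%:R * _]sum1_card natr_sum mulr_suml.
rewrite [RHS](bigID (fun c : {set 'I_n} => P #|c|)) /=.
rewrite [X in _ + X]big1 ?addr0 => [|c /andP[cs Pc]]; last first.
  by apply: big1 => x /eqP->; rewrite (negPf Pc) !mul0r.
apply: eq_big => [c|c]; first by rewrite inE.
rewrite inE => /andP[cs Pc]; rewrite mul1r.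
have c0 : #|c|%:R != 0 :> R.
  by case/imsetP: cs => y _ ->; rewrite pnatr_eq0 card_porbit_neq0.
have -> : \sum_(x | porbit s x == c)
    (P #|porbit s x|)%:R / #|porbit s x|%:R * g #|cycles_avoiding P s x|
  = \sum_(x in c) #|c|%:R^-1 * g #|cycles_of_length P s|.-1.
  apply: eq_big => [x|x /eqP xc]; first by rewrite (mem_porbits _ cs) eq_sym.
  rewrite xc Pc mul1r; congr (_ * g _).
  rewrite (cardsD1 c (cycles_of_length P s)) inE cs Pc /=.
  congr #|pred_of_set _|; apply/finset.setP => d; rewrite !inE andbC.
  by case dP: (d \in porbits s); rewrite ?andbF //= (mem_porbits _ dP) xc.
by rewrite sumr_const -[RHS]mulr_natl mulrA divff // mul1r.
Qed.

(** The function [g] for which [h m = h 0 + m * g m.-1] at every [m]. *)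
Definition discrete_slope (h : nat -> R) (m : nat) : R := (h m.+1 - h 0%N) / m.+1%:R.

Lemma mean_cycles_rec n (h : nat -> R) :
  mean_cycles n h = h 0%N + \sum_(l < n)
    (P l.+1)%:R / l.+1%:R * mean_cycles (n - l.+1) (discrete_slope h).
Proof.
set g := discrete_slope h.
have hE m : h m = h 0%N + m%:R * g m.-1.
  case: m => [|m]; first by rewrite mul0r addr0.
  by rewrite mulrC divfK ?pnatr_eq0 // addrC subrK.
rewrite {1}/mean_cycles; under eq_bigr => s _ do rewrite hE sum_over_cycles.
rewrite big_split /= sumr_const card_Sn mulrDl -[_ *+ _]mulr_natr mulfK ?factR_neq0 //.
congr (_ + _); rewrite exchange_big /=.
case: n => [|n]; first by rewrite !big_ord0 mul0r.
under eq_bigr => x _ do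
  rewrite (sum_marked_cycle x (fun l => (P l)%:R / l%:R) g).
rewrite /= sumr_const card_ord -[X in X / _]mulr_natl mulrA -natrM -factS.
by rewrite mulrC mulKf ?factR_neq0.
Qed.

End Recursion.

(** * Arrays converging along refinements of grids *)

Local Open Scope classical_set_scope.

Section Grid.
Variable R : realType.
Implicit Types (C B : R) (f g : nat -> nat -> R) (W : R -> R).

(** [f N n] stands for the value at [n / N] of an approximation on the grid of
    mesh [1 / N]. Comparing only a grid with its refinements suffices, because
    two grids have a common refinement, and it avoids any mention of the limit
    function. *)
Definition grid_regular C f :=
  [/\ forall N n, (n <= N)%N -> `|f N n| <= C,
      forall N n, (n < N)%N -> `|f N n.+1 - f N n| <= C / N%:R
    & forall N m n, (0 < m)%N -> (n <= N)%N ->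
        `|f (m * N)%N (m * n)%N - f N n| <= C / N%:R].

Lemma grid_regular_cst (c : R) : grid_regular `|c| (fun=> fun=> c).
Proof. by split=> *; rewrite ?subrr ?normr0 ?divr_ge0. Qed.

Lemma grid_regularD C D f g : grid_regular C f -> grid_regular D g ->
  grid_regular (C + D) (fun N n => f N n + g N n).
Proof.
move=> [bf lf rf] [bg lg rg].
split=> [N n nN|N n nN|N m n m0 nN]; rewrite ?mulrDl.
- by rewrite (le_trans (ler_normD _ _)) // lerD ?bf ?bg.
- by rewrite opprD addrACA (le_trans (ler_normD _ _)) // lerD ?lf ?lg.
- by rewrite opprD addrACA (le_trans (ler_normD _ _)) // lerD ?rf ?rg.
Qed.

Lemma grid_regularN C f : grid_regular C f -> grid_regular C (fun N n => - f N n).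
Proof.
move=> [bf lf rf]; split=> [N n nN|N n nN|N m n m0 nN].
- by rewrite normrN bf.
- by rewrite -opprD normrN lf.
- by rewrite -opprD normrN rf.
Qed.

Lemma grid_regular_lip C f N n d : grid_regular C f -> (n + d <= N)%N ->
  `|f N (n + d)%N - f N n| <= d%:R * (C / N%:R).
Proof.
move=> [_ lf _]; elim: d => [|d IHd] le_N; first by rewrite addn0 subrr normr0 mul0r.
have ndN : (n + d < N)%N by rewrite -addnS.
rewrite -(subrKA (f N (n + d)%N)) addnS -natr1 mulrDl mul1r [leRHS]addrC.
by rewrite (le_trans (ler_normD _ _)) // lerD ?lf // IHd // ltnW.
Qed.

Lemma grid_regular_cvg C f : grid_regular C f -> exists l : R, f n n @[n --> \oo] --> l.
Proof.
move=> [bf _ rf].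
have C0 : 0 <= C := le_trans (normr_ge0 _) (bf 0%N 0%N (leqnn _)).
have close n m : (0 < n)%N -> (n <= m)%N -> `|f n n - f m m| <= 2 * C / n%:R.
  move=> n0 nm; have m0 : (0 < m)%N by apply: leq_trans nm.
  rewrite -(subrKA (f (m * n)%N (m * n)%N)) (le_trans (ler_normD _ _)) //.
  rewrite -mulrA mulr_natl mulr2n lerD //; first by rewrite distrC rf.
  rewrite mulnC (le_trans (rf m n m _ _)) //.
  by rewrite ler_wpM2l // lef_pV2 ?posrE ?ltr0n // ler_nat.
apply/cvg_ex/cauchy_cvgP/cauchy_exP => e e0.
pose n := (Num.truncn (2 * C / e)).+1.
exists (f n n); exists n => // m /= nm.
rewrite -ball_normE /= (le_lt_trans (close n m _ nm)) //.
by rewrite ltr_pdivrMr ?ltr0n // [ltRHS]mulrC -ltr_pdivrMr // truncnS_gt.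
Qed.

(** Riemann sum, at right endpoints, of the integral over [0 <= x <= t] of
    [W x * phi (t - x)] at [t = n / N], where [f] approximates [phi]. *)
Definition riemann_conv W f N n : R :=
  N%:R^-1 * \sum_(l < n) W (l.+1%:R / N%:R) * f N (n - l.+1)%N.

Lemma riemann_conv_sub W1 W2 f N n :
  riemann_conv (fun x => W1 x - W2 x) f N n
  = riemann_conv W1 f N n - riemann_conv W2 f N n.
Proof.
rewrite /riemann_conv -mulrBr -sumrB; congr (_ * _).
by apply: eq_bigr => l _; rewrite mulrBl.
Qed.

Lemma sum_blocks (V : nmodType) m n (F : nat -> V) :
  \sum_(i < m * n) F i = \sum_(l < n) \sum_(r < m) F (m * l + r)%N.
Proof.
elim: n => [|n IHn]; first by rewrite muln0 !big_ord0.
by rewrite mulnSr big_split_ord big_ord_recr /= IHn.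
Qed.

(** The sum over the grid of mesh [1 / (m * N)] splits into [n] blocks of [m]
    terms, one for each cell of the coarse grid. Inside a cell the factor [f]
    moves by [O(1 / N)], while [W] moves by at most its drop across the cell;
    these drops telescope to at most [B], so that [W] need not be continuous. *)
Lemma grid_regular_riemann_conv W B C f :
  {homo W : x y /~ x <= y} -> (forall x, 0 <= W x <= B) ->
  grid_regular C f -> grid_regular (3 * (B * C)) (riemann_conv W f).
Proof.
move=> W_dec WB rf; have [bf lf cf] := rf.
have C0 : 0 <= C := le_trans (normr_ge0 _) (bf 0%N 0%N (leqnn _)).
have B0 : 0 <= B by have /andP[/le_trans] := WB 0; apply.
have W0 x : `|W x| <= B by have /andP[? ?] := WB x; rewrite ger0_norm.
have BC0 : 0 <= B * C by rewrite mulr_ge0.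
have term_le N l n : (n <= N)%N -> `|W l * f N n| <= B * C.
  by move=> nN; rewrite normrM ler_pM // bf.
have sum_le N n (F : nat -> R) b : (n <= N)%N -> 0 <= b ->
    (forall l, (l < n)%N -> `|F l| <= b) -> `|\sum_(l < n) F l| <= N%:R * b.
  move=> nN b0 Fb; rewrite (le_trans (ler_norm_sum _ _ _)) //.
  apply: (@le_trans _ _ (\sum_(l < n) b)); first by apply: ler_sum => l _; apply: Fb.
  by rewrite sumr_const card_ord -[leLHS]mulr_natl ler_wpM2r // ler_nat.
split.
- move=> N n nN; rewrite /riemann_conv; case: N => [|N] in nN *.
    by rewrite invr0 mul0r normr0 mulr_ge0.
  rewrite normrM normfV normr_nat ler_pdivrMl ?ltr0n //.
  apply: le_trans (sum_le N.+1 n (fun l => W (l.+1%:R / N.+1%:R) * f N.+1 (n - l.+1)%N)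
    (B * C) nN BC0 _) _; first by move=> l ln; apply: term_le; lia.
  by rewrite ler_wpM2l //; lra.
- move=> N n nN; have N0 : 0 < N%:R :> R by rewrite ltr0n; lia.
  rewrite /riemann_conv -mulrBr normrM normfV normr_nat mulrC ler_wpM2r ?invr_ge0 //.
  rewrite big_ord_recr /= subnn [_ + _ - _]addrAC (le_trans (ler_normD _ _)) //.
  rewrite -sumrB (_ : 3 * (B * C) = 2 * (B * C) + B * C) ?lerD ?term_le //; [|lra].
  under eq_bigr => l _ do rewrite -mulrBr.
  apply: le_trans (sum_le N n (fun l => W (l.+1%:R / N%:R) *
    (f N (n.+1 - l.+1)%N - f N (n - l.+1)%N)) (B * (C / N%:R)) (ltnW nN) _ _) _.
  + by rewrite mulr_ge0 // divr_ge0.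
  + move=> l ln; rewrite normrM ler_pM //.
    by rewrite -[(n.+1 - _)%N](_ : (n - l.+1).+1 = _) ?lf //; lia.
  + rewrite mulrCA [N%:R * _]mulrC divfK ?gt_eqF //; lra.
move=> N m n m0 nN; case: N => [|N'] in nN *.
  by move: nN; rewrite leqn0 => /eqP->; rewrite !muln0 subrr normr0 invr0 mulr0.
have N0 : 0 < N'.+1%:R :> R by rewrite ltr0n.
move: (N'.+1) N0 nN => N N0 nN.
have m0R : 0 < m%:R :> R by rewrite ltr0n.
have mN0 : 0 < (m * N)%:R :> R by rewrite natrM mulr_gt0.
(* [x l r] is the weight at the [r]-th fine point of the [l]-th coarse cell,
   and [y l.+1], [y l] are the weights at the two ends of that cell. *)
pose x l r := W ((m * l + r).+1%:R / (m * N)%:R).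
pose y l := W (l%:R / N%:R).
have xB l r : (r < m)%N -> y l.+1 <= x l r <= y l.
  move=> rm; apply/andP; split; apply: W_dec.
    rewrite ler_pdivrMr // natrM mulrCA divfK ?gt_eqF // -natrM ler_nat; nia.
  rewrite ler_pdivlMr // natrM mulrCA divfK ?gt_eqF // -natrM ler_nat; nia.
have diff_le l r : (l < n)%N -> (r < m)%N ->
    `|x l r * f (m * N)%N (m * n - (m * l + r).+1)%N - y l.+1 * f N (n - l.+1)%N|
    <= 2 * (B * C / N%:R) + C * (y l - y l.+1).
  move=> ln rm; have /andP[yx xy] := xB l r rm.
  set u := f _ _; set v := f N _.
  have -> : x l r * u - y l.+1 * v = x l r * (u - v) + (x l r - y l.+1) * v.
    by rewrite mulrBr mulrBl addrA subrK.
  rewrite (le_trans (ler_normD _ _)) // lerD //; last first.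
    rewrite normrM mulrC ler_pM //; first by apply: bf; lia.
    by rewrite ger0_norm ?subr_ge0 // lerB.
  have uv : `|u - v| <= 2 * (C / N%:R).
    rewrite -(subrKA (f (m * N)%N (m * (n - l.+1))%N)) (le_trans (ler_normD _ _)) //.
    rewrite [2]/(1 + 1) mulrDl !mul1r lerD // ?cf //; last by lia.
    rewrite /u (_ : (m * n - _ = m * (n - l.+1) + (m - r.+1))%N); last by nia.
    rewrite (le_trans (grid_regular_lip rf _)) //; first by nia.
    rewrite mulrCA ler_wpM2l // natrM invfM mulrA ler_piMl ?invr_ge0 ?ler0n //.
    by rewrite ler_pdivrMr // mul1r ler_nat leq_subr.
  rewrite normrM (le_trans (ler_pM _ _ (W0 _) uv)) //.
  by rewrite mulrCA -[B * C / _]mulrA.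
rewrite /riemann_conv (sum_blocks m n (fun i => W (i.+1%:R / (m * N)%:R) *
  f (m * N)%N (m * n - i.+1)%N)).
have -> : N%:R^-1 * \sum_(l < n) W (l.+1%:R / N%:R) * f N (n - l.+1)%N
    = (m * N)%:R^-1 * \sum_(l < n) \sum_(r < m) y l.+1 * f N (n - l.+1)%N.
  under [in RHS]eq_bigr => l _ do rewrite sumr_const card_ord -[_ *+ m]mulr_natl.
  by rewrite -mulr_sumr natrM invfM mulrACA mulVf ?gt_eqF // mul1r.
rewrite -mulrBr normrM normfV normr_nat ler_pdivrMl //.
have -> : (m * N)%:R * (3 * (B * C) / N%:R) = m%:R * (3 * (B * C)).
  by rewrite natrM -mulrA [N%:R * _]mulrC divfK ?gt_eqF.
rewrite -sumrB (le_trans (ler_norm_sum _ _ _)) //.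
apply: (@le_trans _ _ (\sum_(l < n) m%:R * (2 * (B * C / N%:R) + C * (y l - y l.+1)))).
  apply: ler_sum => l _; rewrite -sumrB (le_trans (ler_norm_sum _ _ _)) //.
  apply: (@le_trans _ _ (\sum_(r < m) (2 * (B * C / N%:R) + C * (y l - y l.+1)))).
    by apply: ler_sum => r _; apply: diff_le.
  by rewrite sumr_const card_ord -[leLHS]mulr_natl.
rewrite -mulr_sumr ler_wpM2l // big_split /= sumr_const card_ord -mulr_sumr.
rewrite -(big_mkord xpredT (fun l => y l - y l.+1)).
have -> : \sum_(0 <= l < n) (y l - y l.+1) = y 0%N - y n.
  rewrite -opprB -telescope_sumr // -sumrN.
  by apply: eq_bigr => l _; rewrite opprB.
have nR : n%:R <= N%:R :> R by rewrite ler_nat.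
rewrite -[_ *+ n]mulr_natl.
have le1 : n%:R * (2 * (B * C / N%:R)) <= 2 * (B * C).
  rewrite mulrCA ler_wpM2l // mulrCA ler_piMr //.
  by rewrite ler_pdivrMr // mul1r.
have le2 : C * (y 0%N - y n) <= B * C.
  have /andP[_ y0] := WB (0%:R / N%:R); have /andP[yn _] := WB (n%:R / N%:R).
  by rewrite mulrC ler_wpM2r // lerBlDr (le_trans y0) // lerDl.
by lra.
Qed.

End Grid.

(** * The window of cycle lengths *)

Section Window.
Variables (R : realType) (gamma delta : R).
Hypotheses (gamma_gt0 : 0 < gamma) (gamma_lt_delta : gamma < delta).

Let delta_gt0 : 0 < delta := lt_trans gamma_gt0 gamma_lt_delta.

Definition inv_window (x : R) : R := (gamma <= x <= delta)%R%:R / x.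

Let up (x : R) := (Num.max x gamma)^-1 + (x <= delta)%R%:R / delta.
Let down (x : R) := (Num.max x delta)^-1 + (x < gamma)%R%:R / gamma.

(** The window is the difference of the half-lines above [gamma] and above
    [delta]. On such a half-line [1 / x] is a difference of decreasing functions:
    replacing [x] by its maximum with the threshold extends it by a constant,
    and a multiple of the indicator of the complement cancels this constant. *)
Lemma inv_windowE : inv_window = (fun x => up x - down x).
Proof.
apply/funext => x; rewrite /inv_window /up /down.
have [xd|dx] := leP x delta; have [xg|gx] := ltP x gamma; rewrite /= ?mul1r ?mul0r.
- by rewrite [X in _ - X]addrC subrr.
- by rewrite addr0 addrK.
- by have := lt_trans gamma_lt_delta (lt_trans dx xg); rewrite ltxx.
- by rewrite !addr0 subrr.
Qed.

Lemma inv_max_decr (a : R) : 0 < a -> {homo (fun x => (Num.max x a)^-1) : x y /~ x <= y}.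
Proof.
move=> a0 x y yx; rewrite lef_pV2 ?posrE ?lt_max ?a0 ?orbT //.
by rewrite ge_max !le_max yx lexx orbT.
Qed.

Lemma inv_max_le (a x : R) : 0 < a -> 0 <= (Num.max x a)^-1 <= a^-1.
Proof.
move=> a0; have m0 : 0 < Num.max x a by rewrite lt_max a0 orbT.
by rewrite invr_ge0 (ltW m0) lef_pV2 ?posrE // le_max lexx orbT.
Qed.

Lemma grid_regular_inv_window C f : grid_regular C f ->
  exists D, grid_regular D (riemann_conv inv_window f).
Proof.
move=> rf; pose B := gamma^-1 + delta^-1.
have gV : 0 < gamma^-1 by rewrite invr_gt0.
have dV : 0 < delta^-1 by rewrite invr_gt0.
have up_decr : {homo up : x y /~ x <= y}.
  move=> x y yx; rewrite /up lerD ?inv_max_decr // ler_wpM2r ?(ltW dV) // ler_nat.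
  by case: (leP x delta) => // /(le_trans yx) ->.
have down_decr : {homo down : x y /~ x <= y}.
  move=> x y yx; rewrite /down lerD ?inv_max_decr // ler_wpM2r ?(ltW gV) // ler_nat.
  by case: (ltP x gamma) => // /(le_lt_trans yx) ->.
have upB x : 0 <= up x <= B.
  by rewrite /up /B; have := inv_max_le x gamma_gt0; case: (x <= delta) => /=; lra.
have downB x : 0 <= down x <= B.
  by rewrite /down /B; have := inv_max_le x delta_gt0; case: (x < gamma) => /=; lra.
have := grid_regularD (grid_regular_riemann_conv up_decr upB rf)
  (grid_regularN (grid_regular_riemann_conv down_decr downB rf)).
set D := _ + _ => rD; exists D.
suff -> : riemann_conv inv_window f
    = (fun N n => riemann_conv up f N n - riemann_conv down f N n) by [].
by apply/funext => N; apply/funext => n; rewrite inv_windowE riemann_conv_sub.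
Qed.

(** [k] steps of [mean_cycles_rec], every further contribution being dropped. *)
Fixpoint unrolled_mean (k : nat) (h : nat -> R) (N n : nat) : R :=
  if k is k'.+1
  then h 0%N + riemann_conv inv_window (unrolled_mean k' (discrete_slope h)) N n
  else h 0%N.

Lemma grid_regular_unrolled_mean k h :
  exists C, grid_regular C (unrolled_mean k h).
Proof.
elim: k h => [|k IHk] h /=.
  by exists `|h 0%N|; exact: grid_regular_cst.
have [C /grid_regular_inv_window[D rD]] := IHk (discrete_slope h).
exists (`|h 0%N| + D); apply: grid_regularD rD; exact: grid_regular_cst.
Qed.

Definition window (N : nat) (l : nat) : bool :=
  gamma * N%:R <= l%:R <= delta * N%:R.

(** A cycle counted by the window has at least [gamma * N] points, so fewer
    than [k] of them can be removed in succession from [n] points and nothing is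
    lost by stopping the recursion there. *)
Lemma mean_cycles_unrolled k h N n : (0 < N)%N -> n%:R < k%:R * (gamma * N%:R) ->
  mean_cycles (window N) n h = unrolled_mean k h N n.
Proof.
move=> N0; have NR : 0 < N%:R :> R by rewrite ltr0n.
have gN : 0 < gamma * N%:R by rewrite mulr_gt0.
elim: k => [|k IHk] in n h *; first by rewrite mul0r ltNge ler0n.
move=> nk; rewrite mean_cycles_rec /=; congr (_ + _).
rewrite /riemann_conv mulr_sumr; apply: eq_bigr => l _.
rewrite /inv_window ler_pdivlMr // ler_pdivrMr // -/(window N l.+1).
case wl: (window N l.+1); last by rewrite !mul0r mulr0.
have -> : mean_cycles (window N) (n - l.+1) (discrete_slope h) =
    unrolled_mean k (discrete_slope h) N (n - l.+1).
  apply: IHk; move: wl => /andP[gl _].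
  by rewrite natrB // ltrBlDr (lt_le_trans nk) // -natr1 mulrDl mul1r lerD2l.
by rewrite !mul1r invf_div !mulrA mulVf ?mul1r // gt_eqF.
Qed.

End Window.

Lemma prob_cyclesE (R : realType) (gamma delta : R) (i : int) n :
  prob_cycles gamma delta i n =
  mean_cycles (window gamma delta n) n (fun m => (m%:Z == i)%:R).
Proof.
rewrite /prob_cycles /uniform_prob /mean_cycles; congr (_ / _%:R); last exact: card_Sn.
rewrite -sum1_card natr_sum big_mkcond /=; apply: eq_bigr => s _.
by rewrite inE; case: eqP.
Qed.

Theorem proposition10 (R : realType) (i : int) (gamma delta : R)
  (gamma_gt0 : 0 < gamma) (gamma_lt_delta : gamma < delta)
  (delta_le1 : delta <= 1) :
  exists l : R, prob_cycles gamma delta i n @[n --> \oo] --> l.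
Proof.
pose h (m : nat) : R := (m%:Z == i)%:R.
(* The depth must satisfy [N < k * (gamma * N)], whatever [N > 0]. *)
pose k := (Num.truncn gamma^-1).+1.
have kg : 1 < k%:R * gamma by rewrite -ltr_pdivrMr // mul1r truncnS_gt.
have [C rC] := grid_regular_unrolled_mean gamma_gt0 gamma_lt_delta k h.
have [l cl] := grid_regular_cvg rC.
exists l; apply: cvg_trans cl; apply: near_eq_cvg.
exists 1%N => // n /= n0; rewrite prob_cyclesE.
apply: esym; apply: (@mean_cycles_unrolled _ _ _ gamma_gt0 k h) => //.
by rewrite mulrA ltr_pMl // ltr0n.
Qed.
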